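(* Let $\Lambda$ be a finite dimensional algebra over an algebraically closed field $k$. Then $\Lambda$ is hereditary if and only if every tilting $\Lambda$-module possesses the hereditary property.
   Context: $\operatorname{mod}\Lambda$ is the category of finitely generated right $\Lambda$-modules; $\operatorname{pd}_\Lambda M$ is the projective dimension of $M$; $\operatorname{add}T$ is the full subcategory of $\operatorname{mod}\Lambda$ whose objects are the direct sums of direct summands of $T$; $\operatorname{Gen}T$ is the class of all $X\in\operatorname{mod}\Lambda$ for which there exist an integer $d\ge 0$ and an epimorphism $T^d\to X$. $\Lambda$ is hereditary if its global dimension is at most $1$. Tilting module: a $\Lambda$-module $T\in\operatorname{mod}\Lambda$ such that (1) $\operatorname{pd}_\Lambda T\le 1$; (2) $\operatorname{Ext}^1_\Lambda(T,T)=0$; (3) there exists a short exact sequence $0\to\Lambda_\Lambda\to T'\to T''\to 0$ in $\operatorname{mod}\Lambda$ with $T',T''\in\operatorname{add}T$. Hereditary property: a tilting $\Lambda$-module $T$ possesses the hereditary property if, for every module $M\in\operatorname{Gen}T$, there exists a short exact sequence $0\to T'\to T''\to M\to 0$ in $\operatorname{mod}\Lambda$ with $T',T''\in\operatorname{add}T$. *)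

(* Defs.v *)
From HB Require Import structures.
From mathcomp Require Import all_boot all_order all_algebra all_field.

Set Implicit Arguments.
Unset Strict Implicit.
Unset Printing Implicit Defensive.

Import GRing.Theory.
Local Open Scope ring_scope.

(* The notions below are stated for left modules over a ring [R] and are meant *)
(* to be used with [R := A^c]: a right [A]-module is a left module over the    *)
(* converse ring, where [a *: (b *: x) = (b * a : A) *: x].                    *)

Section Modules.
Variable R : nzRingType.
Implicit Types L M N P S T X Y : lmodType R.

Definition finitely_generated M : Prop :=
  exists (d : nat) (g : 'I_d -> M),
    forall x : M, exists c : 'I_d -> R, x = \sum_i c i *: g i.

Definition surjective M N (f : M -> N) : Prop := forall y, exists x, f x = y.

Definition exact_at L M N (f : L -> M) (g : M -> N) : Prop :=
  forall y, g y = 0 <-> exists x, f x = y.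

Definition short_exact L M N (f : {linear L -> M}) (g : {linear M -> N}) : Prop :=
  [/\ injective f, exact_at f g & surjective g].

Definition isomorphic M N : Prop := exists f : {linear M -> N}, bijective f.

Definition direct_summand S T : Prop :=
  exists S' : lmodType R, isomorphic T (S * S')%type.

(* The structure maps exhibit [X] as the biproduct of the [S i]; for [d = 0]   *)
(* this says that [X] is zero.                                                 *)
Definition is_direct_sum (d : nat) (S : 'I_d -> lmodType R) X : Prop :=
  exists (inj : forall i, {linear S i -> X}) (prj : forall i, {linear X -> S i}),
    [/\ forall i (s : S i), prj i (inj i s) = s,
        forall i j (s : S i), i != j -> prj j (inj i s) = 0
      & forall x : X, x = \sum_i inj i (prj i x)].

Definition in_add T X : Prop :=
  exists (d : nat) (S : 'I_d -> lmodType R),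
    (forall i, direct_summand (S i) T) /\ is_direct_sum S X.

Definition in_Gen T X : Prop :=
  finitely_generated X /\
  exists (d : nat) (f : {linear {ffun 'I_d -> T} -> X}), surjective f.

Definition projective P : Prop :=
  forall X Y (g : {linear X -> Y}) (f : {linear P -> Y}),
    surjective g -> exists h : {linear P -> X}, forall p, g (h p) = f p.

(* Projective resolutions ... -> P 2 -> P 1 -> P 0 -> M -> 0 by finitely       *)
(* generated modules.                                                          *)
Record resolution M := Resolution {
  res_obj :> nat -> lmodType R;
  res_diff : forall i, {linear res_obj i.+1 -> res_obj i};
  res_aug : {linear res_obj 0%N -> M};
  res_fg : forall i, finitely_generated (res_obj i);
  res_projective : forall i, projective (res_obj i);
  res_aug_surj : surjective res_aug;
  res_exact0 : exact_at (res_diff 0%N) res_aug;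
  res_exact : forall i, exact_at (res_diff i.+1) (res_diff i)
}.

Definition pd_le M (n : nat) : Prop :=
  exists P : resolution M, forall i, (n < i)%N -> forall x : P i, x = 0.

Definition gldim_le (n : nat) : Prop :=
  forall M, finitely_generated M -> pd_le M n.

(* Ext^1(M, N) = 0: every 1-cocycle of the complex Hom(P, N) is a coboundary,  *)
(* where P is a projective resolution of M; the cohomology does not depend on  *)
(* P, and P exists when R is Noetherian and M is finitely generated.           *)
Definition Ext1_eq0 M N : Prop :=
  forall (P : resolution M) (f : {linear P 1%N -> N}),
    (forall x : P 2%N, f (res_diff P 1%N x) = 0) ->
    exists g : {linear P 0%N -> N}, forall x : P 1%N, f x = g (res_diff P 0%N x).

(* For [R := A^c], [R^o] is [A] as a right module over itself. *)
Definition tilting T : Prop :=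
  [/\ finitely_generated T,
      pd_le T 1%N,
      Ext1_eq0 T T
    & exists (T' T'' : lmodType R)
             (f : {linear R^o -> T'}) (g : {linear T' -> T''}),
        [/\ in_add T T', in_add T T'' & short_exact f g]].

Definition hereditary_property T : Prop :=
  forall M, in_Gen T M ->
    exists (T' T'' : lmodType R)
           (f : {linear T' -> T''}) (g : {linear T'' -> M}),
      [/\ in_add T T', in_add T T'' & short_exact f g].

End Modules.

Arguments gldim_le R n : clear implicits.

(* The global dimension is that of right modules. *)
Definition hereditary (A : nzRingType) : Prop := gldim_le A^c 1%N.

(* Main.v *)
Require Import Defs.
From HB Require Import structures.
From mathcomp Require Import all_boot all_order all_algebra all_field.
From Stdlib Require Import Classical.

Set Implicit Arguments.
Unset Strict Implicit.
Unset Printing Implicit Defensive.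

Import GRing.Theory.
Local Open Scope ring_scope.

(** If every tilting module has the hereditary property, so does the regular
    module, which is tilting.  Every finitely generated module [M] is generated
    by it, so [M] has a resolution by two modules of the additive closure of the
    regular module, that is, by finitely generated projectives; hence the global
    dimension is at most one ([hereditary_property_regular_gldim]).

    Conversely let the global dimension be at most one, [T] tilting and [M]
    generated by [T].  Since [Hom(T, M)] has finite dimension over the ground
    field, there is [p : T^r -> M] through which every map [T -> M] factors
    ([approximation]); it is onto because [T] generates [M].  Let [K] be its
    kernel.  The claim is that [K] lies in [add T].

    - [Ext^1(T, K) = 0], by the long exact sequence of [Hom(T, -)]
      ([extends_along_kernel]).  The coresolution [0 -> R -> T' -> T'' -> 0] of
      the regular module then shows that [T] generates [K]
      ([tilting_lifts_surjective]), so an approximation [p' : T^s -> K] is again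
      onto.
    - [p'] has a section.  Indeed [Ext^2(M, -) = 0] and
      [Ext^1(T^r, T^s) = 0] give [Ext^1(K, T^s) = 0], and maps [T^r -> K] lift
      along [p'].  This argument is made explicit in [kernel_section], from the
      exact sequence [0 -> Q1 -> K * Q0 -> T^r -> 0] obtained from a projective
      resolution [0 -> Q1 -> Q0 -> M -> 0].
    - So [K] is a direct summand of [T^s].  To be in [add T] it must be a direct
      sum of direct summands of [T] itself, which is the existence half of a
      Krull-Schmidt argument ([retract_add_decomposition]): split [K] by
      idempotents as long as possible; a summand with only trivial idempotents
      has a local endomorphism ring, and its identity is a sum of endomorphisms
      that factor through [T], so one of them is an automorphism. *)

(** * Linear maps, kernels and factorizations *)

Definition linear_map (R : nzRingType) (M N : lmodType R) (f : M -> N)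
    (lf : linear f) : {linear M -> N} :=
  HB.pack f (GRing.isLinear.Build R M N *:%R f lf).

Section Kernel.
Variables (R : nzRingType) (M N : lmodType R) (f : {linear M -> N}).

Definition ker_pred : {pred M} := fun x => f x == 0.

Fact ker_submod_closed : submod_closed ker_pred.
Proof.
split; first by rewrite unfold_in linear0.
by move=> a x y; rewrite !unfold_in linearP => /eqP-> /eqP->; rewrite scaler0 addr0.
Qed.

HB.instance Definition _ :=
  GRing.isSubmodClosed.Build R M ker_pred ker_submod_closed.

Definition ker_mod := {x | x \in ker_pred}.
HB.instance Definition _ := SubChoice.on ker_mod.
HB.instance Definition _ := [SubChoice_isSubLmodule of ker_mod by <:].

Lemma kernel_exists :
  exists (K : lmodType R) (i : {linear K -> M}), injective i /\ exact_at i f.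
Proof.
exists (ker_mod : lmodType R), (val : {linear ker_mod -> M}).
split; first exact: val_inj.
move=> y; split=> [fy0|[x <-]]; last by apply/eqP; exact: (valP x).
have yK : y \in ker_pred by rewrite unfold_in fy0.
by exists (exist _ y yK).
Qed.

End Kernel.

Section Factorization.
Variable R : nzRingType.
Implicit Types A B C K M N T X Y : lmodType R.

Lemma factor_epi A B C (e : {linear A -> B}) (q : {linear A -> C}) :
    surjective e -> (forall x, e x = 0 -> q x = 0) ->
  exists h : {linear B -> C}, forall x, h (e x) = q x.
Proof.
move=> es eq0.
have ex y : exists x, e x == y by have [x <-] := es y; exists x.
pose s y := xchoose (ex y); have sE y : e (s y) = y by apply/eqP/(xchooseP (ex y)).
have qE x y : e x = e y -> q x = q y.
  move=> exy; apply/subr0_eq; rewrite -linearB; apply: eq0.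
  by rewrite linearB exy subrr.
have lh : linear (fun y => q (s y)).
  move=> a x y; rewrite -linearP; apply: qE.
  by rewrite linearP !sE.
by exists (linear_map lh) => x; apply: qE; rewrite sE.
Qed.

Lemma factor_mono A B C (i : {linear A -> B}) (q : {linear C -> B}) :
    injective i -> (forall x, exists y, i y = q x) ->
  exists h : {linear C -> A}, forall x, i (h x) = q x.
Proof.
move=> ii qi.
have ex x : exists y, i y == q x by have [y <-] := qi x; exists y.
pose h x := xchoose (ex x); have hE x : i (h x) = q x by apply/eqP/(xchooseP (ex x)).
have lh : linear h by move=> a x y; apply: ii; rewrite linearP !hE linearP.
by exists (linear_map lh).
Qed.

Lemma bijective_inverse A B (f : {linear A -> B}) :
  bijective f -> exists g : {linear B -> A}, cancel f g /\ cancel g f.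
Proof.
case=> g fK gK.
have lg : linear g by move=> a x y; apply: (can_inj fK); rewrite linearP !gK.
by exists (linear_map lg).
Qed.

Lemma inj_surj_bijective A B (f : {linear A -> B}) :
  injective f -> surjective f -> bijective f.
Proof.
move=> fi fs.
have [//|g gE] := @factor_mono _ _ _ f (idfun : {linear B -> B}) fi.
by exists g => x; [apply: fi; rewrite gE | rewrite gE].
Qed.

Lemma sum_map_linear (n : nat) A B (f : 'I_n -> {linear A -> B}) :
  linear (fun x : {ffun 'I_n -> A} => \sum_i f i (x i)).
Proof.
move=> a x y; rewrite scaler_sumr -big_split /=.
by apply: eq_bigr => i _; rewrite !ffunE linearP.
Qed.

Lemma tuple_map_linear (n : nat) A B (f : 'I_n -> {linear A -> B}) :
  linear (fun x : A => [ffun i => f i x]).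
Proof. by move=> a x y; apply/ffunP=> i; rewrite !ffunE linearP. Qed.

Definition sum_map n A B (f : 'I_n -> {linear A -> B}) := linear_map (sum_map_linear f).
Definition tuple_map n A B (f : 'I_n -> {linear A -> B}) :=
  linear_map (tuple_map_linear f).

Lemma sum_mapE n A B (f : 'I_n -> {linear A -> B}) x : sum_map f x = \sum_i f i (x i).
Proof. by []. Qed.

Lemma tuple_mapE n A B (f : 'I_n -> {linear A -> B}) x i : tuple_map f x i = f i x.
Proof. exact: ffunE. Qed.

Definition coord_inj n A (i : 'I_n) : {linear A -> {ffun 'I_n -> A}} :=
  locked (tuple_map (fun j : 'I_n => if j == i then (idfun : {linear A -> A}) else \0)).

Lemma coord_injE n A (i j : 'I_n) (x : A) : coord_inj A i x j = if j == i then x else 0.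
Proof. by rewrite /coord_inj -lock tuple_mapE; case: (j == i). Qed.

Lemma sum_coord_inj n A (x : {ffun 'I_n -> A}) : x = \sum_i coord_inj A i (x i).
Proof.
apply/ffunP=> j; rewrite sum_ffunE (bigD1 j) //= coord_injE eqxx big1 ?addr0 //.
by move=> i /negPf nij; rewrite coord_injE eq_sym nij.
Qed.

Lemma ffun_map_sum n A B (f : {linear {ffun 'I_n -> A} -> B}) x :
  f x = \sum_i f (coord_inj A i (x i)).
Proof. by rewrite {1}(sum_coord_inj x) linear_sum. Qed.

Definition retract M N := exists (s : {linear M -> N}) (p : {linear N -> M}), cancel s p.

(** The complement of a retract is the kernel of its retraction. *)
Lemma direct_summand_retract M N : direct_summand M N <-> retract M N.
Proof.
split=> [[S' [f fb]]|[s [p sK]]].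
  have [g [fK gK]] := bijective_inverse fb.
  have l0 : linear (fun x : M => (x, 0 : S')).
    by move=> a x y; congr pair; rewrite /= scaler0 addr0.
  exists (g \o linear_map l0 : {linear M -> N}), (fst \o f : {linear N -> M}) => x.
  by rewrite /= gK.
have [K [i [ii ik]]] := kernel_exists p.
have [w wE] : exists w : {linear N -> K}, forall x, i (w x) = x - s (p x).
  have [x|w wE] := @factor_mono _ _ _ i (idfun \- (s \o p) : {linear N -> N}) ii.
    by apply/ik; rewrite /= linearB /= sK subrr.
  by exists w.
have lf : linear (fun x : N => (p x, w x)) by move=> a x y; rewrite !linearP.
exists K, (linear_map lf); apply: inj_surj_bijective => [x y /= [pxy wxy]|[m z]].
  by rewrite -[x](subrK (s (p x))) -wE wxy pxy wE subrK.
have piz : p (i z) = 0 by apply/ik; exists z.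
exists (s m + i z); congr (_, _); first by rewrite linearD /= sK piz addr0.
by apply: ii; rewrite wE linearD /= sK piz addr0 addrC addKr.
Qed.

Lemma retract_trans M N X : retract M N -> retract N X -> retract M X.
Proof.
move=> [s [p sK]] [t [q tK]].
by exists (t \o s : {linear M -> X}), (p \o q : {linear X -> M}) => x; rewrite /= tK.
Qed.

Lemma retract_refl M : retract M M.
Proof. by exists (idfun : {linear M -> M}), (idfun : {linear M -> M}). Qed.

Lemma in_add_retract T X : in_add T X -> exists n, retract X {ffun 'I_n -> T}.
Proof.
move=> [n [S [ST [inj [prj [_ _ idE]]]]]].
have [s /fin_all_exists[p sK]] := fin_all_exists
  (fun i => (direct_summand_retract (S i) T).1 (ST i)).
exists n, (tuple_map (fun i => s i \o prj i : {linear X -> T})).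
exists (sum_map (fun i => inj i \o p i : {linear T -> X})) => x.
by rewrite sum_mapE [RHS]idE; apply: eq_bigr => i _; rewrite tuple_mapE /= sK.
Qed.

Lemma in_add_ffun n T : in_add T {ffun 'I_n -> T}.
Proof.
exists n, (fun _ => T); split=> [i|].
  by apply/direct_summand_retract; exact: retract_refl.
have lp (i : 'I_n) : linear (fun x : {ffun 'I_n -> T} => x i).
  by move=> a x y; rewrite !ffunE.
exists (@coord_inj n T), (fun i => linear_map (lp i)); split=> [i s|i j s|x] /=.
- by rewrite coord_injE eqxx.
- by rewrite coord_injE eq_sym => /negPf->.
- exact: sum_coord_inj.
Qed.

End Factorization.

(** * Vanishing of first extension groups *)

Section Extensions.
Variable R : nzRingType.
Implicit Types A B C K M N P T X Y : lmodType R.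

(** For an exact sequence [0 -> A -> B -> C -> 0] with [B] projective this says
    that [Ext^1(C, X) = 0]. *)
Definition extends_along A B (d : {linear A -> B}) X :=
  forall f : {linear A -> X}, exists g : {linear B -> X}, forall x, f x = g (d x).

Definition lifts_along T X Y (p : {linear X -> Y}) :=
  forall h : {linear T -> Y}, exists h' : {linear T -> X}, forall t, p (h' t) = h t.

(** Vanishing of [Ext^1(C, X)] in a form that does not mention a projective
    resolution of [C], so that it passes easily to direct summands of [C]. *)
Definition ext_vanishes C X :=
  forall A B (f : {linear A -> B}) (g : {linear B -> C}),
    short_exact f g -> extends_along f X.

Lemma pd_le1_presentation M : pd_le M 1 ->
  exists P1 P0 (d : {linear P1 -> P0}) (e : {linear P0 -> M}),
    [/\ projective P1, projective P0, short_exact d e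
      & forall N, Ext1_eq0 M N -> extends_along d N].
Proof.
move=> [P P0]; exists (P 1%N), (P 0%N), (res_diff P 0), (res_aug P).
split; [exact: res_projective|exact: res_projective| |].
  split; [|exact: res_exact0|exact: res_aug_surj].
  apply: raddf_inj => x /(@res_exact _ _ P 0 _)[y <-].
  by rewrite (P0 2%N isT y) linear0.
by move=> N ext f; apply: ext => x; rewrite (P0 2%N isT x) !linear0.
Qed.

Definition zero_module : lmodType R := 'rV[R]_0.

Lemma zero_moduleP (x : zero_module) : x = 0.
Proof. by apply/rowP; case. Qed.

Lemma zero_module_fg : finitely_generated zero_module.
Proof.
exists 0%N, (fun _ => 0) => x; exists (fun _ => 0).
by rewrite big_ord0; exact: zero_moduleP.
Qed.

Lemma zero_module_projective : projective zero_module.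
Proof.
move=> X Y g f _; exists (\0 : {linear zero_module -> X}) => p.
by rewrite (zero_moduleP p) !linear0.
Qed.

Lemma presentation_pd_le1 M P1 P0 (d : {linear P1 -> P0}) (e : {linear P0 -> M}) :
    finitely_generated P1 -> projective P1 ->
    finitely_generated P0 -> projective P0 -> short_exact d e ->
  pd_le M 1.
Proof.
move=> fg1 pr1 fg0 pr0 [di ex es].
pose obj i := match i with 0%N => P0 | 1%N => P1 | _ => zero_module end.
pose diff i : {linear obj i.+1 -> obj i} :=
  match i return {linear obj i.+1 -> obj i} with
  | 0%N => d
  | 1%N => (\0 : {linear zero_module -> P1})
  | _.+2 => (\0 : {linear zero_module -> zero_module})
  end.
have objfg i : finitely_generated (obj i).
  by case: i => [|[|i]] //=; exact: zero_module_fg.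
have objpr i : projective (obj i).
  by case: i => [|[|i]] //=; exact: zero_module_projective.
have diffex i : exact_at (diff i.+1) (diff i).
  case: i => [|i] y; last first.
    by rewrite (zero_moduleP y) linear0; split=> // _; exists 0; rewrite linear0.
  split=> [dy|[x <-]]; last by rewrite /= linear0.
  by exists 0; rewrite linear0; apply: di; rewrite linear0.
exists (@Resolution R M obj diff e objfg objpr es ex diffex) => -[|[|i]] //= _ x.
exact: zero_moduleP.
Qed.

(** The resolution in the definition of [Ext^1] is arbitrary, so it need not be
    the trivial one; but its augmentation splits, and so the kernel of the
    augmentation is a direct summand of the term in degree zero. *)
Lemma projective_Ext1_eq0 M N : projective M -> Ext1_eq0 M N.
Proof.
move=> Mpr P f f0.
have [s sE] := Mpr _ _ (res_aug P) (idfun : {linear M -> M}) (@res_aug_surj _ _ P).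
have [K [i [ii ik]]] := kernel_exists (res_aug P).
have [x|d' d'E] := @factor_mono _ _ _ _ i (res_diff P 0) ii.
  by apply/ik/(@res_exact0 _ _ P _); exists x.
have [y|x|f' f'E] := @factor_epi _ _ _ _ d' f.
- have /ik/(@res_exact0 _ _ P _)[x xE] : exists z, i z = i y by exists y.
  by exists x; apply: ii; rewrite d'E.
- move=> d'x; have /(@res_exact _ _ P 0 _)[z <-] : res_diff P 0 x = 0.
    by rewrite -d'E d'x linear0.
  exact: f0.
have [x|w wE] := @factor_mono _ _ _ _ i
    (idfun \- (s \o res_aug P) : {linear P 0%N -> P 0%N}) ii.
  by apply/ik; rewrite linearB /= sE subrr.
exists (f' \o w : {linear P 0%N -> N}) => x /=.
rewrite -f'E; congr (f' _); apply: ii; rewrite wE d'E /=.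
have -> : res_aug P (res_diff P 0 x) = 0 by apply/(@res_exact0 _ _ P _); exists x.
by rewrite linear0 subr0.
Qed.

Lemma extends_along_ffun A B (d : {linear A -> B}) X n :
  extends_along d X -> extends_along d {ffun 'I_n -> X}.
Proof.
move=> ext f.
have lc (i : 'I_n) : linear (fun x : {ffun 'I_n -> X} => x i).
  by move=> a x y; rewrite !ffunE.
have [g gE] := fin_all_exists (fun i => ext (linear_map (lc i) \o f : {linear A -> X})).
by exists (tuple_map g) => x; apply/ffunP=> i; rewrite tuple_mapE -gE.
Qed.

(** In the long exact sequence of [Hom(C, -)] on [0 -> K -> X -> M -> 0], the
    group [Ext^1(C, K)] lies between the cokernel of [Hom(C, X) -> Hom(C, M)] and
    [Ext^1(C, X)], which both vanish. *)
Lemma extends_along_kernel A B C (d : {linear A -> B}) (e : {linear B -> C})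
    K X M (i : {linear K -> X}) (p : {linear X -> M}) :
    short_exact d e -> injective i -> exact_at i p -> lifts_along C p ->
  extends_along d X -> extends_along d K.
Proof.
move=> [_ ex es] ii ik lift ext r.
have [s sE] := ext (i \o r : {linear A -> X}).
have [x ex0|t tE] := @factor_epi _ _ _ _ e (p \o s : {linear B -> M}) es.
  move: ex0 => /ex[y <-] /=; rewrite -sE; apply/ik; by exists (r y).
have [t' t'E] := lift t.
have [x|w wE] := @factor_mono _ _ _ _ i (s \- (t' \o e) : {linear B -> X}) ii.
  by apply/ik; rewrite linearB /= t'E tE subrr.
exists w => x; apply: ii; rewrite wE /= -sE /=.
have -> : e (d x) = 0 by apply/ex; exists x.
by rewrite linear0 subr0.
Qed.

(** [B] is the quotient of [A * P0^n] by the relations coming from [P1^n], so a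
    map [B -> X] is a map [u] on [A] together with maps on the copies of [P0]
    that agree with [u] on those relations. *)
Lemma ext_vanishes_ffun P1 P0 C (d : {linear P1 -> P0}) (e : {linear P0 -> C}) X n :
    projective P0 -> short_exact d e -> extends_along d X ->
  ext_vanishes {ffun 'I_n -> C} X.
Proof.
move=> prP [di dex es] ext A B f g [fi fex gs] u.
have [q qE] := fin_all_exists (fun i =>
  prP _ _ g (coord_inj C i \o e : {linear P0 -> _}) gs).
have rex i : exists r : {linear P1 -> A}, forall x, f (r x) = q i (d x).
  apply: (@factor_mono _ _ _ _ f (q i \o d : {linear P1 -> B}) fi) => x.
  apply/fex; rewrite /= qE /=.
  have -> : e (d x) = 0 by apply/dex; exists x.
  exact: linear0.
have [r rE] := fin_all_exists rex.
have [s sE] := fin_all_exists (fun i => ext (u \o r i : {linear P1 -> X})).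
(* The map cover is onto B, and glue vanishes on its kernel: a pair (a, y) in
   this kernel has y i = d (z i) and a = - \sum_i r i (z i). *)
pose cover := (f \o fst) \+ (sum_map q \o snd)
  : {linear (A * {ffun 'I_n -> P0})%type -> B}.
pose glue := (u \o fst) \+ (sum_map s \o snd)
  : {linear (A * {ffun 'I_n -> P0})%type -> X}.
have gq y : g (sum_map q y) = [ffun i => e (y i)].
  rewrite sum_mapE linear_sum; apply/ffunP=> j; rewrite sum_ffunE (bigD1 j) //= qE /=.
  rewrite coord_injE eqxx big1 ?addr0 ?ffunE // => i /negPf nij.
  by rewrite qE /= coord_injE eq_sym nij.
have gf a : g (f a) = 0 by apply/fex; exists a.
have [b|[a y] /= ay0|v vE] := @factor_epi _ _ _ _ cover glue.
- have [y yE] := fin_all_exists (fun i => es (g b i)).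
  have : g (b - sum_map q (finfun y)) = 0.
    by rewrite linearB gq; apply/ffunP=> i; rewrite !ffunE yE subrr.
  by move/fex=> [a aE]; exists (a, finfun y); rewrite /= aE subrK.
- have ey i : e (y i) = 0.
    have /ffunP/(_ i) := gq y; rewrite ffunE => <-.
    rewrite -[sum_map q y](addKr (f a)) ay0 addr0 linearN gf oppr0.
    by rewrite ffunE.
  have [z zE] := fin_all_exists (fun i => (dex (y i)).1 (ey i)).
  have aE : a = - \sum_i r i (z i).
    apply/subr0_eq/fi; rewrite opprK linearD linear0 linear_sum -[RHS]ay0.
    by congr (_ + _); apply: eq_bigr => i _; rewrite rE zE.
  rewrite aE linearN linear_sum addrC; apply/subr0_eq; rewrite subr0.
  by apply/eqP; rewrite subr_eq0; apply/eqP; apply: eq_bigr => i _; rewrite -zE -sE.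
exists v => a; have := vE (a, 0).
rewrite -[cover _]/(f a + sum_map q 0) -[glue _]/(u a + sum_map s 0).
by rewrite !linear0 !addr0.
Qed.

(** Pull the sequence back along [p : D -> C], extend there, and restrict along
    [b |-> (b, s (g b))]. *)
Lemma ext_vanishes_retract C D X : retract C D -> ext_vanishes D X -> ext_vanishes C X.
Proof.
move=> [s [p sK]] ext A B f g [fi fex gs] u.
pose diff := (g \o fst) \- (p \o snd) : {linear (B * D)%type -> C}.
have [L [i [ii ik]]] := kernel_exists diff.
have lA : linear (fun a : A => (f a, 0 : D)).
  by move=> a x y; congr pair; rewrite ?linearP /= ?scaler0 ?addr0.
have lB : linear (fun b : B => (b, s (g b))).
  by move=> a x y; congr pair; rewrite !linearP.
have [a|f' f'E] := @factor_mono _ _ _ _ i (linear_map lA) ii.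
  by apply/ik; rewrite /= linear0 subr0; apply/fex; exists a.
have [b|j jE] := @factor_mono _ _ _ _ i (linear_map lB) ii.
  by apply/ik; rewrite /= sK subrr.
have [|v vE] := ext _ _ f' (snd \o i : {linear L -> D}) _ u; last first.
  exists (v \o j : {linear B -> X}) => a; rewrite vE /=; congr (v _); apply: ii.
  rewrite jE f'E /=; have -> : g (f a) = 0 by apply/fex; exists a.
  by rewrite linear0.
split=> [x y /(congr1 i)|x|c].
- by rewrite !f'E => -[] /fi.
- split=> [/= ix0|[a <-]]; last by rewrite /= f'E.
  have : diff (i x) = 0 by apply/ik; exists x.
  rewrite /= ix0 linear0 subr0 => /fex[a aE]; exists a; apply: ii.
  by rewrite f'E /= aE -ix0; case: (i x).
have [b bE] := gs (p c).
have /ik[x xE] : diff (b, c) = 0 by rewrite /= bE subrr.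
by exists x; rewrite /= xE.
Qed.

(** A map through which all maps from [T] factor has in its image everything
    that [T] generates. *)
Lemma lifts_along_surjective T X Y (p : {linear X -> Y}) n
    (f : {linear {ffun 'I_n -> T} -> Y}) :
  surjective f -> lifts_along T p -> surjective p.
Proof.
move=> fs lift y; have [t <-] := fs y.
have [h hE] := fin_all_exists (fun i => lift (f \o coord_inj T i : {linear T -> Y})).
exists (sum_map h t); rewrite sum_mapE linear_sum ffun_map_sum.
by apply: eq_bigr => i _; rewrite hE.
Qed.

Lemma lifts_along_retract C D X Y (p : {linear X -> Y}) :
  retract C D -> lifts_along D p -> lifts_along C p.
Proof.
move=> [s [r sK]] lift h; have [h' hE] := lift (h \o r : {linear D -> Y}).
by exists (h' \o s : {linear C -> X}) => c; rewrite /= hE /= sK.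
Qed.

Lemma lifts_along_ffun T X Y (p : {linear X -> Y}) n :
  lifts_along T p -> lifts_along {ffun 'I_n -> T} p.
Proof.
move=> lift h.
have [h' hE] := fin_all_exists (fun i => lift (h \o coord_inj T i : {linear T -> Y})).
exists (sum_map h') => t; rewrite sum_mapE linear_sum ffun_map_sum.
by apply: eq_bigr => i _; rewrite hE.
Qed.

(** An element of [X] is a map from the regular module, which extends to the
    module [T'] of [add T]; so [X] is generated by [add T], hence by [T]. *)
Lemma tilting_lifts_surjective T X Y (p : {linear Y -> X}) T' T''
    (f : {linear R^o -> T'}) (g : {linear T' -> T''}) :
    short_exact f g -> in_add T T' ->
    ext_vanishes T'' X -> lifts_along T p -> surjective p.
Proof.
move=> fg addT' ext lift x.
have lx : linear (fun c : R^o => c *: x) by move=> a b c; rewrite scalerDl scalerA.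
have [v vE] := ext _ _ _ _ fg (linear_map lx).
have [n T'n] := in_add_retract addT'.
have [h hE] := lifts_along_retract T'n (lifts_along_ffun (n := n) lift) v.
by exists (h (f 1)); rewrite hE -vE /= scale1r.
Qed.

End Extensions.

(** * Finite dimension over a central subfield *)

(** A free family in [V] of maximal length spans [V]. *)
Lemma maximal_free_family (k : fieldType) n (V : 'rV[k]_n -> Prop) :
  exists r (B : 'M[k]_(r, n)), [/\ row_free B, forall i, V (row i B)
    & forall v, V v -> exists w, v = w *m B].
Proof.
suff grow m r (B : 'M[k]_(r, n)) :
    row_free B -> (forall i, V (row i B)) -> (n <= r + m)%N ->
    exists r' (B' : 'M[k]_(r', n)), [/\ row_free B', forall i, V (row i B')
      & forall v, V v -> exists w, v = w *m B'].
  by apply: (grow n 0%N 0); [rewrite /row_free mxrank0|case|].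
elim: m r B => [|m IH] r B Bfree VB nr.
  exists r, B; split=> // v _; apply/submxP; apply: submx_full.
  by rewrite -col_leq_rank (eqP Bfree) -[r]addn0.
case: (classic (forall v, V v -> exists w, v = w *m B)) => [span|nspan].
  by exists r, B.
have [v nv] := not_all_ex_not _ _ nspan.
have [Vv nvB] := imply_to_and _ _ nv.
apply: (IH (1 + r)%N (col_mx v B)).
- rewrite -row_leq_rank -addsmxE.
  have vB : ~~ (v <= B)%MS by apply/negP => /submxP.
  have : (B < v + B)%MS.
    by rewrite ltmxE addsmxSr /=; apply: contra vB; exact: submx_trans (addsmxSl _ _).
  move/rank_ltmx; rewrite (eqP Bfree); exact.
- move=> i; case: (split_ordP i) => j ->; first by rewrite rowKu row_id.
  by rewrite rowKd.
- by rewrite add1n addSnnS.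
Qed.

(** The ground field enters through a ring morphism with central image, the
    structure map of an algebra; in this form it is the same for an algebra and
    for its converse. *)
Section CentralSubfield.
Variables (k : fieldType) (R : nzRingType) (iota : {rmorphism k -> R}).
Hypothesis iota_central : forall c r, iota c * r = r * iota c.
Implicit Types K L M N S T X Y : lmodType R.

Definition comb n X (u : 'I_n -> X) (c : 'rV[k]_n) : X :=
  \sum_i iota (c 0 i) *: u i.

Definition spanned n X := exists u : 'I_n -> X, forall x, exists c, x = comb u c.

Lemma comb_linear n X (u : 'I_n -> X) a c d :
  comb u (a *: c + d) = iota a *: comb u c + comb u d.
Proof.
rewrite scaler_sumr -big_split; apply: eq_bigr => i _.
by rewrite !mxE rmorphD rmorphM scalerDl scalerA.
Qed.

Lemma comb0 n X (u : 'I_n -> X) : comb u 0 = 0.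
Proof. by apply: big1 => i _; rewrite mxE rmorph0 scale0r. Qed.

Lemma comb_sum n X (u : 'I_n -> X) m (a : 'rV_m) (c : 'I_m -> 'rV_n) :
  comb u (\sum_j a 0 j *: c j) = comb (fun j => comb u (c j)) a.
Proof.
apply: (big_rec2 (fun x y => comb u x = y)) => [|j x y _ <-]; first exact: comb0.
exact: comb_linear.
Qed.

Lemma comb_mulmx n X (u : 'I_n -> X) m (a : 'rV_m) (B : 'M_(m, n)) :
  comb u (a *m B) = comb (fun j => comb u (row j B)) a.
Proof. by rewrite mulmx_sum_row comb_sum. Qed.

Lemma eq_comb n X (u v : 'I_n -> X) c : u =1 v -> comb u c = comb v c.
Proof. by move=> uv; apply: eq_bigr => i _; rewrite uv. Qed.

Lemma map_comb n X Y (f : {linear X -> Y}) (u : 'I_n -> X) c :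
  f (comb u c) = comb (fun i => f (u i)) c.
Proof. by rewrite linear_sum; apply: eq_bigr => i _; rewrite linearZ. Qed.

Lemma spanned_surjective n X Y (f : {linear X -> Y}) :
  surjective f -> spanned n X -> spanned n Y.
Proof.
move=> fs [u uP]; exists (fun i => f (u i)) => y.
by have [x <-] := fs y; have [c ->] := uP x; exists c; rewrite map_comb.
Qed.

(** The dimension count behind induction on direct summands: a submodule needs
    at most [n] generators over the field, and a proper one fewer. *)
Lemma spanned_submodule n X L (j : {linear L -> X}) :
    spanned n X -> injective j ->
  exists r, [/\ (r <= n)%N, spanned r L & r = n -> surjective j].
Proof.
move=> [u uP] ji; pose V c := exists l, j l = comb u c.
have Vl a x y : V x -> V y -> V (a *: x + y).
  move=> [l lE] [l' l'E]; exists (iota a *: l + l').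
  by rewrite linearP lE l'E comb_linear.
have V0 : V 0 by exists 0; rewrite linear0 comb0.
have [r [B [Bfree VB Bspan]]] := maximal_free_family V.
exists r; split; first by rewrite -(eqP Bfree) rank_leq_col.
  have [l lE] := fin_all_exists VB.
  exists l => x; have [c cE] := uP (j x).
  have [w wE] : exists w, c = w *m B by apply: Bspan; exists x.
  exists w; apply: ji; rewrite cE wE comb_mulmx map_comb.
  by apply: eq_comb => i; rewrite lE.
move=> rn x; have [c ->] := uP x.
have /submxP[w ->] : (c <= B)%MS.
  by apply: submx_full; rewrite -col_leq_rank (eqP Bfree) rn.
rewrite mulmx_sum_row; suff [l lE] : V (\sum_i w 0 i *: row i B) by exists l.
by elim/big_rec: _ => [|i y _ Vy]; [exact: V0|exact: Vl].
Qed.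

Lemma iota_scale_linear c X : linear (fun x : X => iota c *: x).
Proof. by move=> a x y; rewrite scalerDr !scalerA iota_central. Qed.

Definition homothety c X := linear_map (@iota_scale_linear c X).

Lemma comb_map_linear n X Y (h : 'I_n -> {linear X -> Y}) c :
  linear (fun x => comb (fun i => h i x) c).
Proof.
move=> a x y; rewrite /comb scaler_sumr -big_split; apply: eq_bigr => i _ /=.
by rewrite linearP scalerDr !scalerA iota_central.
Qed.

Definition comb_map n X Y (h : 'I_n -> {linear X -> Y}) c :=
  linear_map (comb_map_linear h c).

(** A linear map is determined by the matrix of the images of the [n] generators
    of [X] in terms of the [m] generators of [Y]; so the maps are spanned by
    those attached to a maximal free family of such matrices. *)
Lemma hom_spanned n m X Y : spanned n X -> spanned m Y ->
  exists r (h : 'I_r -> {linear X -> Y}),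
    forall f : {linear X -> Y}, exists c, forall x, f x = comb (fun l => h l x) c.
Proof.
move=> [u uP] [v vP].
pose V (c : 'rV[k]_(n * m)) :=
  exists h : {linear X -> Y}, forall i, h (u i) = comb v (row i (vec_mx c)).
have [r [B [_ VB Bspan]]] := maximal_free_family V.
have [h hE] := fin_all_exists VB.
exists r, h => f.
have [M ME] := fin_all_exists (fun i => vP (f (u i))).
have [w wE] : exists w, mxvec (\matrix_i M i) = w *m B.
  by apply: Bspan; exists f => i; rewrite mxvecK rowK.
exists w => x; have [c ->] := uP x.
rewrite -[RHS]/(comb_map h w (comb u c)) !map_comb; apply: eq_comb => i /=.
rewrite ME -[M i](rowK M) -[\matrix_i _]mxvecK wE mulmx_sum_row !linear_sum.
rewrite (eq_bigr (fun l => w 0 l *: row i (vec_mx (row l B)))); last first.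
  by move=> l _; rewrite !linearZ.
by rewrite comb_sum; apply: eq_comb => l; rewrite hE.
Qed.

(** Combine a spanning family of [Hom(T, Y)] into one map; the coefficients of
    [f : T -> Y] act on [T] because the field is central. *)
Lemma approximation n m T Y : spanned n T -> spanned m Y ->
  exists r (p : {linear {ffun 'I_r -> T} -> Y}), lifts_along T p.
Proof.
move=> sT sY; have [r [h hP]] := hom_spanned sT sY.
exists r, (sum_map h) => f; have [c cE] := hP f.
exists (tuple_map (fun l => homothety (c 0 l) T)) => t.
rewrite sum_mapE cE; apply: eq_bigr => l _; rewrite tuple_mapE.
by rewrite linearZ.
Qed.

(** * Direct summands of powers of a module *)

Definition nontrivial X := exists x : X, x <> 0.

Definition trivial_idempotents X := forall e : {linear X -> X},
  (forall x, e (e x) = e x) -> (forall x, e x = 0) \/ (forall x, e x = x).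

Lemma iter_linear X (f : {linear X -> X}) i : linear (iter i f).
Proof.
by elim: i => // i IH a x y; rewrite /= -linearP; congr (f _); exact: IH.
Qed.

Definition iter_map X (f : {linear X -> X}) i := linear_map (iter_linear f i).

(** The iterates of [f] are linearly dependent.  In a relation
    [c_i f^i + c_(i+1) f^(i+1) + ... = 0] with [c_i] invertible, dividing by [c_i]
    writes [f^i] as a polynomial in [f] times [f^(i+1)]. *)
Lemma iter_stabilizes n X (f : {linear X -> X}) : spanned n X ->
  exists i (g : {linear X -> X}),
    (forall x, g (f x) = f (g x)) /\ (forall x, iter i f x = g (iter i.+1 f x)).
Proof.
move=> sX; have [r [h hP]] := hom_spanned sX sX.
have [w wE] := fin_all_exists (fun j : 'I_r.+1 => hP (iter_map f j)).
pose W := \matrix_j w j.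
have [c c0 cW] : exists2 c : 'rV_r.+1, c != 0 & c *m W = 0.
  have : kermx W != 0 by rewrite kermx_eq0 -row_leq_rank -ltnNge ltnS rank_leq_col.
  by case/rowV0Pn=> c /sub_kermxP cW c0; exists c.
have rel x : \sum_(j < r.+1) iota (c 0 j) *: iter j f x = 0.
  transitivity (comb (fun l => h l x) (c *m W)); last by rewrite cW comb0.
  rewrite comb_mulmx; apply: eq_bigr => j _; rewrite rowK -wE.
  by [].
have : exists i, [exists j : 'I_r.+1, (val j == i) && (c 0 j != 0)].
  by have /rV0Pn[j cj] := c0; exists (val j); apply/existsP; exists j; rewrite eqxx.
case/ex_minnP=> i /existsP[i0 /andP[/eqP<- ci]] imin.
(* The polynomial by which f^(i0 + 1) must be multiplied to give f^i0; the row
   vanishes for j <= i0, where the truncated exponent is meaningless. *)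
pose g := comb_map (fun j : 'I_r.+1 => iter_map f (j - i0.+1))
  (\row_j (if (i0 < j)%N then - (c 0 i0)^-1 * c 0 j else 0)).
have gE m x : g (iter m f x) = iter m f (g x).
  rewrite -[RHS]/(iter_map f m (g x)) [in RHS]map_comb; apply: eq_comb => j /=.
  by rewrite -!iterD addnC.
exists i0, g; split=> x; first exact: (gE 1%N).
have := rel x; rewrite (bigD1 i0) //= => /eqP; rewrite addr_eq0 => /eqP E.
have {}E : iter i0 f x = iota (- (c 0 i0)^-1) *:
    \sum_(j < r.+1 | j != i0) iota (c 0 j) *: iter j f x.
  rewrite -[X in iota _ *: X]opprK -E scalerN -scaleNr -rmorphN opprK scalerA -rmorphM.
  by rewrite mulVf // rmorph1 scale1r.
rewrite [LHS]E scaler_sumr [RHS](bigD1 i0) //= mxE ltnn rmorph0 scale0r add0r.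
apply: eq_bigr => j ji; rewrite mxE scalerA -rmorphM.
case: ltngtP => [ij|ij|ij].
- by rewrite -[in LHS](subnK ij) iterD.
- suff -> : c 0 j = 0 by rewrite mulr0 rmorph0 !scale0r.
  apply/eqP/negPn/negP=> cj; suff : (i0 <= j)%N by rewrite leqNgt ij.
  by apply: imin; apply/existsP; exists j; rewrite eqxx.
- by case/eqP: ji; apply: val_inj.
Qed.

(** Fitting's lemma.  From [f^i = g f^(i+1)] with [g] commuting with [f] one gets
    [f^i = g^i f^(2i)], so [g^i f^i] is idempotent.  If it is zero then [f^i] is
    zero, and if it is the identity then [g] is inverse to [f]. *)
Lemma endo_bijective_or_nilpotent n X (f : {linear X -> X}) :
    spanned n X -> trivial_idempotents X ->
  bijective f \/ exists i, forall x, iter i f x = 0.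
Proof.
move=> sX triv; have [i [g [gf fg]]] := iter_stabilizes f sX.
have gfi m x : iter m g (f x) = f (iter m g x).
  by elim: m => //= m ->; rewrite gf.
have gif m l x : iter m g (iter l f x) = iter l f (iter m g x).
  by elim: l => //= l IH; rewrite gfi IH.
have fgm m x : iter i f x = iter m g (iter (m + i) f x).
  elim: m => // m IH; rewrite iterSr addSnnS iterD -[g _]/(iter 1 g _) gif /= -fg.
  by rewrite -iterD.
pose e := iter_map g i \o iter_map f i : {linear X -> X}.
have [x|e0|e1] := triv e.
- by rewrite /e /= -[iter i f (iter i g _)]gif -[iter i f (iter i f _)]iterD -fgm.
- by right; exists i => x; rewrite (fgm i) iterD; exact: (e0 (iter i f x)).
have gfK : cancel f g.
  by move=> x; rewrite -[LHS]e1 -[RHS]e1 /= -(gif 1%N i) /= -[iter i f (f x)]iterSr -fg.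
by left; exists g => // x; rewrite -gf.
Qed.

(** The endomorphism ring is local: if [f + g] is invertible with inverse [v] and
    neither [f] nor [g] is, then [v f] and [v g] are nilpotent with sum the
    identity; so [v g] is injective and nilpotent. *)
Lemma bijective_addend n X (f g : {linear X -> X}) :
    spanned n X -> trivial_idempotents X -> bijective (fun x => f x + g x) ->
  nontrivial X -> bijective f \/ bijective g.
Proof.
move=> sX triv fgb [x0 x0n].
have [v [uK vK]] := @bijective_inverse _ _ _ (f \+ g : {linear X -> X}) fgb.
have bij_of (h : {linear X -> X}) : bijective (v \o h) -> bijective h.
  move=> vhb; apply: (eq_bij (bij_comp fgb vhb)) => x.
  exact: (vK (h x)).
have [|[i fi0]] := endo_bijective_or_nilpotent (v \o f) sX triv.
  by left; apply: bij_of.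
have [|[j gj0]] := endo_bijective_or_nilpotent (v \o g) sX triv.
  by right; apply: bij_of.
have fixed0 x : v (f x) = x -> x = 0.
  move=> fx; rewrite -(fi0 x); elim: i {fi0} => //= i IH.
  by rewrite -IH fx.
have ker0 x : v (g x) = 0 -> x = 0.
  move=> gx; apply: fixed0; rewrite -[RHS]uK /= linearD /= gx addr0.
  by [].
case: x0n; elim: j gj0 => [|j IH] gj0; first exact: (gj0 x0).
by apply: IH => x; apply: ker0; exact: gj0.
Qed.

Lemma bijective_summand n d X (f : 'I_d -> {linear X -> X}) :
    spanned n X -> trivial_idempotents X -> nontrivial X ->
  bijective (fun x => \sum_i f i x) -> exists i, bijective (f i).
Proof.
move=> sX triv [x0 x0n]; elim: d f => [|d IH] f bf.
  by case: x0n; apply: (bij_inj bf); rewrite !big_ord0.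
have lg : linear (fun x => \sum_i f (lift ord0 i) x).
  move=> a x y; rewrite scaler_sumr -big_split.
  by apply: eq_bigr => i _; rewrite linearP.
have [||bf0|bg] := bijective_addend (f := f ord0) (g := linear_map lg) sX triv.
- by apply: (eq_bij bf) => x; rewrite big_ord_recl.
- by exists x0.
- by exists ord0.
by have [i bi] := IH _ bg; exists (lift ord0 i).
Qed.

Lemma idempotent_splits X (e : {linear X -> X}) : (forall x, e (e x) = e x) ->
  exists S (i : {linear S -> X}) (p : {linear X -> S}),
    cancel i p /\ forall x, i (p x) = e x.
Proof.
move=> ee; have [S [i [ii ik]]] := kernel_exists (idfun \- e : {linear X -> X}).
have [x|p pE] := @factor_mono _ _ _ _ i e ii.
  by apply/ik; rewrite /= ee subrr.
exists S, i, p; split=> // x; apply: ii; rewrite pE.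
by apply/esym/subr0_eq/(ik (i x)); exists x.
Qed.

Definition factors_through T X (e : {linear X -> X}) :=
  exists (b : {linear X -> T}) (a : {linear T -> X}), forall x, a (b x) = e x.

(** Membership in [add T] as seen inside the endomorphism ring of [X]; without
    a family of varying summands, decompositions are easy to combine. *)
Definition add_decomposition T X := exists d (e : 'I_d -> {linear X -> X}),
  [/\ forall i x, e i (e i x) = e i x,
      forall i j x, i != j -> e j (e i x) = 0,
      forall x, x = \sum_i e i x
    & forall i, factors_through T (e i)].

(** The image of an idempotent [e = a b] that factors through [T] is a direct
    summand of [T]: on that image [e] is the identity. *)
Lemma add_decomposition_in_add T X : add_decomposition T X -> in_add T X.
Proof.
move=> [d [e [ee eij e1 eT]]].
have [S /fin_all_exists[i /fin_all_exists[p ipE]]] :=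
  fin_all_exists (fun j => idempotent_splits (ee j)).
exists d, S; split=> [j|].
  have [b [a abE]] := eT j; have [iK pE] := ipE j.
  apply/direct_summand_retract; exists (b \o i j : {linear S j -> T}).
  exists (p j \o a : {linear T -> S j}) => s /=.
  by rewrite abE -pE !iK.
exists i, p; split=> [j s|j l s jl|x].
- by have [-> _] := ipE j.
- have [iK pE] := ipE j; have [iKl pEl] := ipE l.
  by apply: (can_inj iKl); rewrite pEl -[s]iK pE eij // linear0.
- by rewrite [LHS]e1; apply: eq_bigr => j _; have [_ ->] := ipE j.
Qed.

Lemma add_decomposition_biproduct T X X1 X2
    (i1 : {linear X1 -> X}) (p1 : {linear X -> X1})
    (i2 : {linear X2 -> X}) (p2 : {linear X -> X2}) :
    cancel i1 p1 -> cancel i2 p2 -> (forall x, x = i1 (p1 x) + i2 (p2 x)) ->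
  add_decomposition T X1 -> add_decomposition T X2 -> add_decomposition T X.
Proof.
move=> i1K i2K sum1 [d1 [e1 [ee1 eij1 s1 t1]]] [d2 [e2 [ee2 eij2 s2 t2]]].
have p21 x : p2 (i1 x) = 0.
  have := sum1 (i1 x); rewrite i1K -[LHS]addr0 => /addrI/esym.
  by rewrite -(linear0 i2) => /(can_inj i2K).
have p12 x : p1 (i2 x) = 0.
  have := sum1 (i2 x); rewrite i2K -[LHS]add0r => /addIr/esym.
  by rewrite -(linear0 i1) => /(can_inj i1K).
pose e (l : 'I_(d1 + d2)) : {linear X -> X} := match split l with
  | inl j => i1 \o e1 j \o p1 | inr j => i2 \o e2 j \o p2 end.
have el j : e (lshift d2 j) = (i1 \o e1 j \o p1) by rewrite /e (unsplitK (inl j)).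
have er j : e (rshift d1 j) = (i2 \o e2 j \o p2) by rewrite /e (unsplitK (inr j)).
exists (d1 + d2)%N, e; split.
- move=> l x; case: (split_ordP l) => j ->; rewrite ?el ?er /=.
    by rewrite i1K ee1.
  by rewrite i2K ee2.
- move=> l l' x; case: (split_ordP l) => j ->; case: (split_ordP l') => j' -> jj;
    rewrite ?el ?er /= ?p12 ?p21 ?i1K ?i2K ?linear0 //.
    rewrite eij1 ?linear0 //; apply: contraNneq jj => ->; exact: eqxx.
  by rewrite eij2 ?linear0 //; apply: contraNneq jj => ->.
- move=> x; rewrite big_split_ord /= {1}(sum1 x) {1}(s1 (p1 x)) {1}(s2 (p2 x)) !linear_sum.
  by congr (_ + _); apply: eq_bigr => j _; rewrite ?el ?er.
- move=> l; case: (split_ordP l) => j ->; rewrite ?el ?er.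
    have [b [a abE]] := t1 j.
    by exists (b \o p1 : {linear X -> T}), (i1 \o a : {linear T -> X}) => x /=; rewrite abE.
  have [b [a abE]] := t2 j.
  by exists (b \o p2 : {linear X -> T}), (i2 \o a : {linear T -> X}) => x /=; rewrite abE.
Qed.

(** By induction on the number of generators over the field.  A nontrivial
    idempotent splits [X] into two smaller retracts.  Otherwise the identity of
    [X] is the sum over the [d] coordinates of maps [X -> T -> X], and since the
    endomorphism ring is local one of these is an automorphism. *)
Lemma retract_add_decomposition n T X d :
  spanned n X -> retract X {ffun 'I_d -> T} -> add_decomposition T X.
Proof.
elim/ltn_ind: n X => n IH X sX XT.
case: (classic (trivial_idempotents X)) => [triv|].
  case: (classic (nontrivial X)) => [nontriv|X0]; last first.
    exists 0%N, (fun _ => \0); split=> [[]|[]|x|[]] //.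
    by rewrite big_ord0; apply: NNPP => x0; apply: X0; exists x.
  have [s [p sK]] := XT.
  have lc (i : 'I_d) : linear (fun x : {ffun 'I_d -> T} => x i).
    by move=> a x y; rewrite !ffunE.
  have [|i bi] := @bijective_summand n d X
    (fun i => p \o coord_inj T i \o linear_map (lc i) \o s) sX triv nontriv.
    by exists id => x; rewrite /= -ffun_map_sum sK.
  have [g [_ gK]] := bijective_inverse bi.
  exists 1%N, (fun _ => idfun); split=> [//|i1 i2|x|_].
  - by rewrite !ord1 eqxx.
  - by rewrite big_ord1.
  exists (linear_map (lc i) \o s \o g : {linear X -> T}).
  exists (p \o coord_inj T i : {linear T -> X}).
  by move=> x; exact: gK.
move=> ntriv; have [e ne] := not_all_ex_not _ _ ntriv.
have [ee n01] := imply_to_and _ _ ne; have [e0 e1] := not_or_and _ _ n01.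
have [S1 [i1 [p1 [i1K pE1]]]] := idempotent_splits ee.
have [x|S2 [i2 [p2 [i2K pE2]]]] := @idempotent_splits X (idfun \- e).
  by rewrite /= linearB /= ee subrr subr0.
apply: (@add_decomposition_biproduct T X _ _ i1 p1 i2 p2) => // [x||].
- by rewrite pE1 pE2 /= addrC subrK.
- have [r [rn sr rE]] := spanned_submodule sX (can_inj i1K).
  apply: (IH r) => //; last by apply: retract_trans XT; exists i1, p1.
  rewrite ltn_neqAle rn andbT; apply/eqP => /rE surj.
  by apply: e1 => x; have [y <-] := surj x; rewrite -pE1 i1K.
have [r [rn sr rE]] := spanned_submodule sX (can_inj i2K).
apply: (IH r) => //; last by apply: retract_trans XT; exists i2, p2.
rewrite ltn_neqAle rn andbT; apply/eqP => /rE surj.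
apply: e0 => x; have [y <-] := surj x.
have := pE2 (i2 y); rewrite i2K /= -[LHS]addr0 => /addrI/esym/eqP.
by rewrite oppr_eq0 => /eqP.
Qed.

End CentralSubfield.

(** * Finitely generated and free modules *)

Section Free.
Variable R : nzRingType.
Implicit Types E K M N X Y : lmodType R.

Lemma finitely_generated_cover X : finitely_generated X ->
  exists d (f : {linear {ffun 'I_d -> R^o} -> X}), surjective f.
Proof.
move=> [d [g gP]]; have lg i : linear (fun c : R^o => c *: g i).
  by move=> a b c; rewrite scalerDl scalerA.
exists d, (sum_map (fun i => linear_map (lg i))) => x.
have [c ->] := gP x; exists (finfun c); rewrite sum_mapE.
by apply: eq_bigr => i _; rewrite ffunE.
Qed.

Lemma finitely_generated_surjective X Y (f : {linear X -> Y}) :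
  surjective f -> finitely_generated X -> finitely_generated Y.
Proof.
move=> fs [d [g gP]]; exists d, (fun i => f (g i)) => y.
have [x <-] := fs y; have [c ->] := gP x; exists c.
by rewrite linear_sum; apply: eq_bigr => i _; rewrite linearZ.
Qed.

Lemma finitely_generated_free n : finitely_generated {ffun 'I_n -> R^o}.
Proof.
exists n, (fun i => coord_inj R^o i 1) => x; exists x.
rewrite {1}(sum_coord_inj x); apply: eq_bigr => i _.
by rewrite -linearZ /= [_ *: 1]mulr1.
Qed.

Lemma projective_free n : projective {ffun 'I_n -> R^o}.
Proof.
move=> X Y g f gs.
have [x xE] := fin_all_exists (fun i : 'I_n => gs (f (coord_inj R^o i 1))).
have lx i : linear (fun c : R^o => c *: x i).
  by move=> a b c; rewrite scalerDl scalerA.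
exists (sum_map (fun i => linear_map (lx i))) => c.
rewrite sum_mapE linear_sum ffun_map_sum; apply: eq_bigr => i _ /=.
rewrite linearZ xE -!linearZ /=; congr (f (_ _)); exact: mulr1.
Qed.

Lemma projective_retract X Y : retract X Y -> projective Y -> projective X.
Proof.
move=> [s [p sK]] prY A B g f gs.
have [h hE] := prY _ _ g (f \o p : {linear Y -> B}) gs.
by exists (h \o s : {linear X -> A}) => x; rewrite /= hE /= sK.
Qed.

Lemma finitely_generated_retract X Y :
  retract X Y -> finitely_generated Y -> finitely_generated X.
Proof. by move=> [s [p sK]]; apply: finitely_generated_surjective => x; exists (s x). Qed.

Lemma regular_retract : retract R^o {ffun 'I_1 -> R^o}.
Proof.
exists (coord_inj R^o ord0), (sum_map (fun _ => idfun)) => x.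
by rewrite sum_mapE big_ord1 coord_injE.
Qed.

Lemma in_add_regular X : in_add (R^o : lmodType R) X -> finitely_generated X /\ projective X.
Proof.
case/in_add_retract=> n Xn; split.
  exact: finitely_generated_retract Xn (finitely_generated_free n).
exact: projective_retract Xn (@projective_free n).
Qed.

(** * The regular module *)

Lemma regular_tilting : tilting (R^o : lmodType R).
Proof.
have Rfg : finitely_generated (R^o : lmodType R).
  exact: finitely_generated_retract regular_retract (finitely_generated_free 1).
have Rpr : projective (R^o : lmodType R).
  exact: projective_retract regular_retract (@projective_free 1).
split=> //.
- apply: (@presentation_pd_le1 _ _ (zero_module R) R^o \0 idfun) => //.
  + exact: zero_module_fg.
  + exact: zero_module_projective.
  split=> [x y _|x|x]; first by rewrite (zero_moduleP x) (zero_moduleP y).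
    by split=> [/= ->|[z <-]//]; exists 0.
  by exists x.
- exact: projective_Ext1_eq0.
exists R^o, (zero_module R), idfun, \0; split.
- exists 1%N, (fun _ => R^o); split=> [i|].
    by apply/direct_summand_retract; exact: retract_refl.
  exists (fun _ => idfun), (fun _ => idfun); split=> // [i j s|x].
    by rewrite !ord1.
  by rewrite big_ord1.
- exists 0%N, (fun _ => zero_module R); split=> [[]|] //.
  exists (fun _ => idfun), (fun _ => idfun); split=> // [[]//|x].
  by rewrite big_ord0; exact: zero_moduleP.
split=> [//|x|x]; first by split=> // _; exists x.
by exists 0; rewrite linear0 (zero_moduleP x).
Qed.

Lemma hereditary_property_regular_gldim :
  hereditary_property (R^o : lmodType R) -> gldim_le R 1.
Proof.
move=> her M Mfg.
have [|T1 [T0 [d [e [a1 a0 ex]]]]] := her M.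
  by split=> //; exact: finitely_generated_cover.
have [fg1 pr1] := in_add_regular a1; have [fg0 pr0] := in_add_regular a0.
exact: presentation_pd_le1 fg1 pr1 fg0 pr0 ex.
Qed.

(** * Tilting modules in global dimension one *)

(** With [q : Q0 -> X] lifting [eQ], the sequence [0 -> Q1 -> K * Q0 -> X -> 0] is
    exact.  The first projection [K * Q0 -> K], restricted to the projective
    module [Q1], lifts to [E], and this lift extends to [L : K * Q0 -> E].  The
    difference between the projection and [p' L] vanishes on [Q1], so it comes
    from a map [X -> K], which lifts along [p'].  Correcting [L] by that lift
    gives a lift of the whole projection, and its restriction to [K] is a
    section of [p']. *)
Lemma kernel_section (Q1 Q0 M X K E : lmodType R)
    (dQ : {linear Q1 -> Q0}) (eQ : {linear Q0 -> M})
    (i : {linear K -> X}) (p : {linear X -> M}) (p' : {linear E -> K}) :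
    projective Q1 -> projective Q0 -> short_exact dQ eQ -> short_exact i p ->
    surjective p' -> ext_vanishes X E -> lifts_along X p' ->
  exists s : {linear K -> E}, cancel s p'.
Proof.
move=> pr1 pr0 [di dex es] [ii iex ps] p's ext lift.
have [q qE] := pr0 _ _ p eQ ps.
have pi0 k : p (i k) = 0 by apply/iex; exists k.
have [z|r rE] := @factor_mono _ _ _ _ i (q \o dQ : {linear Q1 -> X}) ii.
  by apply/iex; rewrite /= qE; apply/dex; exists z.
have lsigma : linear (fun z : Q1 => (- r z, dQ z)).
  by move=> a x y; congr pair; [exact: (linearP (\- r)) | exact: linearP].
pose sigma := linear_map lsigma.
pose pi := (i \o fst) \+ (q \o snd) : {linear (K * Q0)%type -> X}.
have ex : short_exact sigma pi.
  split=> [x y [_ /di]//|[k y]|x].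
    split=> [/= kq0|[z [<- <-]]]; last by rewrite /= linearN rE addNr.
    have [z zE] : exists z, dQ z = y.
      by apply/dex; rewrite -qE -[RHS](linear0 p) -kq0 linearD pi0 add0r.
    exists z; congr pair => //; apply: ii; rewrite linearN rE /= zE.
    by apply/eqP; rewrite eq_sym -addr_eq0 kq0.
  have [y yE] := es (p x).
  have /iex[k kE] : p (x - q y) = 0 by rewrite linearB qE yE subrr.
  by exists (k, y); rewrite /= kE subrK.
have [l lE] := pr1 _ _ p' r p's.
have [L LE] := ext _ _ _ _ ex (\- l : {linear Q1 -> E}).
have [x|x|t tE] := @factor_epi _ _ _ _ pi (fst \- (p' \o L) : {linear (K * Q0)%type -> K}).
- by case: ex => _ _; apply.
- case: ex => _ /(_ x) exx _ /exx[z <-] /=.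
  have Lz : L (- r z, dQ z) = - l z := esym (LE z).
  by rewrite Lz linearN lE opprK addNr.
have [t' t'E] := lift t.
have l1 : linear (fun k : K => (k, 0 : Q0)).
  by move=> a x y; congr pair; rewrite /= scaler0 addr0.
exists ((L \o linear_map l1) \+ (t' \o i) : {linear K -> E}) => k /=.
rewrite linearD t'E; have := tE (k, 0); rewrite /= linear0 addr0 => ->.
by rewrite addrC subrK.
Qed.

End Free.

Section Tilting.
Variables (k : fieldType) (R : nzRingType) (iota : {rmorphism k -> R}).
Hypothesis iota_central : forall c r, iota c * r = r * iota c.
Implicit Types M T X : lmodType R.

Lemma spanned_ffun n m X : spanned iota m X ->
  exists r, spanned iota r {ffun 'I_n -> X}.
Proof.
move=> [u uP]; exists #|{: 'I_n * 'I_m}|.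
exists (fun l => coord_inj X (enum_val l).1 (u (enum_val l).2)) => x.
have [c cE] := fin_all_exists (fun i => uP (x i)).
exists (\row_l c (enum_val l).1 0 (enum_val l).2).
rewrite {1}(sum_coord_inj x).
under eq_bigr => i _ do rewrite cE map_comb.
rewrite pair_bigA /= big_enum_val; apply: eq_bigr => l _; rewrite mxE.
by [].
Qed.

Lemma finitely_generated_spanned n X :
  spanned iota n R^o -> finitely_generated X -> exists r, spanned iota r X.
Proof.
move=> sR /finitely_generated_cover[d [f fs]].
have [r sr] := spanned_ffun d sR; exists r; exact: spanned_surjective fs sr.
Qed.

(** The kernel of an approximation [T^r -> M] is a retract of a power of [T]. *)
Lemma tilting_hereditary_property n T :
  spanned iota n R^o -> gldim_le R 1 -> tilting T -> hereditary_property T.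
Proof.
move=> sR gl [Tfg Tpd Text [T0 [T1 [f [g [aT0 aT1 fg]]]]]] M [Mfg [d [F Fs]]].
have [P1 [P0 [dP [eP [_ prP0 exP ext]]]]] := pd_le1_presentation Tpd.
have [Q1 [Q0 [dQ [eQ [prQ1 prQ0 exQ _]]]]] := pd_le1_presentation (gl M Mfg).
have extT := ext T Text.
have [nT sT] := finitely_generated_spanned sR Tfg.
have [nM sM] := finitely_generated_spanned sR Mfg.
have [r [p lp]] := approximation iota_central sT sM.
have ps := lifts_along_surjective Fs lp.
have [K [i [ii ik]]] := kernel_exists p.
have extK := extends_along_kernel exP ii ik lp (extends_along_ffun (n := r) extT).
have [nr sTr] := spanned_ffun r sT.
have [m [_ sK _]] := spanned_submodule sTr ii.
have [s [p' lp']] := approximation iota_central sT sK.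
have [t T1t] := in_add_retract aT1.
have p's := tilting_lifts_surjective fg aT0
  (ext_vanishes_retract T1t (ext_vanishes_ffun prP0 exP extK)) lp'.
have ext' := ext_vanishes_ffun (n := r) prP0 exP (extends_along_ffun (n := s) extT).
have [h hK] := kernel_section prQ1 prQ0 exQ (And3 ii ik ps)
  p's ext' (lifts_along_ffun lp').
exists K, {ffun 'I_r -> T}, i, p; split=> //.
  apply: add_decomposition_in_add.
  by apply: (retract_add_decomposition iota_central sK (d := s)); exists h, p'.
exact: in_add_ffun.
Qed.

End Tilting.

Theorem theorem1p4 (k : closedFieldType) (A : falgType k) :
  hereditary A <-> (forall T : lmodType A^c, tilting T -> hereditary_property T).
Proof.
split=> [her T Ttilt|her]; last first.
  by apply: hereditary_property_regular_gldim; apply: her; exact: regular_tilting.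
have iota_add : zmod_morphism (fun c : k => c%:A : A^c).
  by move=> a b; exact: (scalerBl a b (1 : A)).
have iota_mul : monoid_morphism (fun c : k => c%:A : A^c).
  split; first exact: (scale1r (1 : A)).
  by move=> a b; rewrite mulrC; exact: (rmorphM (in_alg A)).
pose iota : {rmorphism k -> A^c} := HB.pack (fun c : k => c%:A : A^c)
  (GRing.isZmodMorphism.Build k A^c _ iota_add)
  (GRing.isMonoidMorphism.Build k A^c _ iota_mul).
have iota_central (c : k) (r : A^c) : iota c * r = r * iota c.
  apply: (etrans (y := c *: (r : A))); first exact: mulr_algr.
  exact/esym/mulr_algl.
apply: (tilting_hereditary_property iota_central (n := \dim {:A}) _ her Ttilt).
exists (fun i => (vbasis {:A})`_i) => x.
exists (\row_i coord (vbasis {:A}) i (x : A)).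
rewrite {1}(coord_vbasis (memvf (x : A))); apply: eq_bigr => i _; rewrite mxE.
exact/esym/mulr_algr.
Qed.
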